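(* For each integer $n\ge1$, let $Y=Y_n=\max_{1\le k\le 2n}X_k$ be the maximum value of the sockuence of a uniformly random matching on $[2n]$. There exists a constant $C>0$ such that $$\lim_{n\to\infty}\mathbb{P}\left(\left|Y-\frac n2\right|\le C\sqrt{n\log n}\right)=1.$$
   Context: $[m]=\{1,2,\dots,m\}$. A matching on $[2n]$ (an ordered matching of size $n$) is a partition of $[2n]$ into $n$ two-element subsets, called edges. For a matching $M$ on $[2n]$ and $k\in[2n]$, let $x_k(M)$ be the number of edges of $M$ with one endpoint in $[k]$ and the other in $[2n]\setminus[k]$. The sequence $(x_k(M))_{k=1}^{2n}$ is called the sockuence of $M$. Let $\mathbf{M}_n$ be a matching chosen uniformly at random from all $\frac{(2n)!}{2^n n!}$ matchings on $[2n]$, and let $X_k=x_k(\mathbf{M}_n)$ for $k\in[2n]$. *)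

(* Defs.v *)
From mathcomp Require Import all_boot all_order all_algebra.
From mathcomp Require Import reals.

Set Implicit Arguments.
Unset Strict Implicit.
Unset Printing Implicit Defensive.

Import Order.TTheory GRing.Theory Num.Theory.

Local Open Scope ring_scope.

(* The vertex set [2n] = {1, ..., 2n} is encoded by 'I_(2 * n), the ordinal i
   standing for the vertex i + 1; hence vertex i lies in [k] iff (i < k)%N. *)

Definition matchings (n : nat) : {set {set {set 'I_(2 * n)}}} :=
  [set M | partition M [set: 'I_(2 * n)] && [forall e in M, #|e| == 2%N]].

Definition crosses (n k : nat) (e : {set 'I_(2 * n)}) : bool :=
  [exists i, exists j, [&& e == [set i; j], (i < k)%N & ~~ (j < k)%N]].

Definition sock (n k : nat) (M : {set {set 'I_(2 * n)}}) : nat :=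
  #|[set e in M | crosses k e]|.

Definition max_sock (n : nat) (M : {set {set 'I_(2 * n)}}) : nat :=
  (\max_(1 <= k < (2 * n).+1) sock k M)%N.

Definition unif_prob (R : realType) (T : finType) (A : {set T}) (E : pred T)
    : R :=
  #|[set x in A | E x]|%:R / #|A|%:R.

(* Main.v *)
(* Write X_k for the sockuence and N = 2n. Relabelling by transpositions gives
   the probability 1/(N-1) for a given edge and 1/((N-1)(N-3)) for two given
   disjoint edges. Since X_l - X_k is the sum, over the vertices of the block
   [k, l), of the side (+1 right, -1 left, 0 inside) of their partners, the
   centred sockuence D_k = X_k - k(N-k)/(N-1) satisfies
   E (D_l - D_k)^2 <= 3(l - k).
   The lower bound on the maximum is Chebyshev's inequality at k = n. For the
   upper bound, X_k changes by at most 1 at each step, so it suffices to control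
   it at the points n + jg and n - jg with g ~ sqrt n. At distance d from n the
   mean of X_k is about d^2/N lower than at n, which leaves room j^2/8 at the
   j-th points on top of s = sqrt (n ln n); the probability that
   D_{n+jg} - D_n exceeds s + j^2/8 is at most 3jg/(s + j^2/8)^2, and these
   bounds sum to O(g/s) = o(1). *)
Require Import Defs.
From mathcomp Require Import all_boot all_order all_algebra.
From mathcomp Require Import all_classical all_reals all_analysis.
From mathcomp Require Import perm finset zify ring lra.

Set Implicit Arguments.
Unset Strict Implicit.
Unset Printing Implicit Defensive.

Import Order.TTheory GRing.Theory Num.Theory.
Import numFieldNormedType.Exports.

Local Open Scope ring_scope.

(** * Matchings: partners, relabelling, existence *)

Lemma matching_partner n (M : {set {set 'I_(2 * n)}}) v : M \in matchings n ->
  exists w, w != v /\ forall w', ([set v; w'] \in M) = (w' == w).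
Proof.
rewrite inE => /andP[partM /'forall_implyP card2].
have triv := partition_trivIset partM.
have vM : v \in cover M by rewrite (cover_partition partM) inE.
have BM := pblock_mem vM; have vB : v \in pblock M v by rewrite mem_pblock.
have /cards2P[x [y [xy defB]]] := card2 _ BM.
have [w [wv defB']] : exists w, w != v /\ pblock M v = [set v; w].
  move: vB; rewrite defB !inE => /orP[]/eqP->; first by exists y; rewrite eq_sym.
  by exists x; rewrite setUC.
exists w; split=> // w'; apply/idP/eqP => [w'M|->]; last by rewrite -defB'.
have w'v : w' != v.
  by apply/eqP => E; have := card2 _ w'M; rewrite E cards2 eqxx.
(* Blocks are disjoint, so an edge through [v] can only be the block of [v]. *)
have /setP/(_ w') : pblock M v = [set v; w'].
  by apply: def_pblock => //; rewrite !inE eqxx.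
by rewrite defB' !inE eqxx orbT (negPf w'v) /= => /eqP.
Qed.

Definition relabel n (p : {perm 'I_(2 * n)}) (M : {set {set 'I_(2 * n)}}) :
  {set {set 'I_(2 * n)}} := [set p @: (e : {set _}) | e in M].

Lemma relabel_matchings n (p : {perm 'I_(2 * n)}) M :
  (relabel p M \in matchings n) = (M \in matchings n).
Proof.
have pI : injective p by exact: perm_inj.
have pT : p @: [set: 'I_(2 * n)] = [set: 'I_(2 * n)].
  by apply/setP=> x; rewrite !inE -[x](permKV p) imset_f ?inE.
rewrite !inE -{1}pT (imset_partition _ _ pI); congr andb.
apply/'forall_implyP/'forall_implyP => H e eM.
  by rewrite -(card_imset _ pI) H ?imset_f.
by have /imsetP[f fM ->] := eM; rewrite card_imset ?H.
Qed.

Lemma matchings_gt0 n : (0 < #|matchings n|)%N.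
Proof.
pose f (i : 'I_(2 * n)) := minn i (rev_ord i).
(* The fibres of [f] are the pairs of mirror images, which form the nested matching; no vertex is
   its own mirror image because [2 * n] is even. *)
apply/card_gt0P; exists (preim_partition f [set: _]).
rewrite inE preim_partitionP /=; apply/'forall_implyP => _ /imsetP[x _ ->].
apply/cards2P; exists x, (rev_ord x); split.
  by apply/eqP => /(congr1 val) /=; have := ltn_ord x; lia.
apply/setP => y; rewrite !inE /= /f -!val_eqE /=.
by have := ltn_ord x; have := ltn_ord y; lia.
Qed.

(** * Uniform mean and edge probabilities *)

Section Mean.
Variables (R : realFieldType) (n : nat).
Notation V := 'I_(2 * n).
Notation N := ((2 * n)%:R : R).
Implicit Types (F : {set {set V}} -> R) (M : {set {set V}}) (v w : V).

Definition mean F : R := (\sum_(M in matchings n) F M) / #|matchings n|%:R.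

Definition edge M v w : R := ([set v; w] \in M)%:R.

Lemma eq_mean F G : {in matchings n, F =1 G} -> mean F = mean G.
Proof. by move=> FG; rewrite /mean (eq_bigr _ FG). Qed.

Lemma le_mean F G : {in matchings n, forall M, F M <= G M} -> mean F <= mean G.
Proof. by move=> FG; rewrite ler_wpM2r ?ler_sum// invr_ge0 ler0n. Qed.

Lemma mean_sum (I : Type) (r : seq I) (P : pred I) (F : I -> _ -> R) :
  mean (fun M => \sum_(i <- r | P i) F i M) = \sum_(i <- r | P i) mean (F i).
Proof. by rewrite /mean exchange_big mulr_suml. Qed.

Lemma meanD F G : mean (fun M => F M + G M) = mean F + mean G.
Proof. by rewrite /mean big_split mulrDl. Qed.

Lemma meanZ c F : mean (fun M => c * F M) = c * mean F.
Proof. by rewrite /mean -mulr_sumr mulrA. Qed.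

Lemma mean_cst c : mean (fun=> c) = c.
Proof.
rewrite /mean sumr_const -[c *+ _]mulr_natr mulfK //.
by rewrite pnatr_eq0 -lt0n matchings_gt0.
Qed.

Lemma mean_perm (p : {perm V}) F :
  mean F = mean (fun M => F (relabel p M)).
Proof.
(* [relabel p] is the image map of the image map of [p], so injectivity lifts twice and the sum can
   be reindexed. *)
rewrite /mean [in LHS](reindex_inj (imset_inj (imset_inj (@perm_inj _ p)))) /=.
by congr (_ / _); apply: eq_bigl => M; rewrite relabel_matchings.
Qed.

Lemma edge_perm (p : {perm V}) M v w :
  edge (relabel p M) (p v) (p w) = edge M v w.
Proof.
rewrite /edge /relabel -(mem_imset M _ (imset_inj (@perm_inj _ p))).
by rewrite imsetU !imset_set1.
Qed.

Lemma edgeC M v w : edge M v w = edge M w v.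
Proof. by rewrite /edge setUC. Qed.

Lemma edge_idem M v w : edge M v w * edge M v w = edge M v w.
Proof. by rewrite /edge; case: (_ \in _); rewrite ?mul1r ?mul0r. Qed.

Lemma sum_edge M v : M \in matchings n -> \sum_w edge M v w = 1.
Proof.
case/(matching_partner v) => w [_ Mv].
rewrite (bigD1 w) //= /edge Mv eqxx big1 ?addr0 // => w' /negPf.
by rewrite Mv => ->.
Qed.

Lemma edge_diag M v : M \in matchings n -> edge M v v = 0.
Proof.
by case/(matching_partner v) => w [wv Mv]; rewrite /edge Mv eq_sym (negPf wv).
Qed.

Lemma edge_disjoint M v w w' : M \in matchings n -> w != w' ->
  edge M v w * edge M v w' = 0.
Proof.
case/(matching_partner v) => u [_ Mv] ww'; rewrite /edge !Mv.
by have [<-|] := eqVneq w u; rewrite ?mul0r // eq_sym (negPf ww') mulr0.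
Qed.

(** The transposition of [w] and [w'] fixes [v], so the [N - 1] possible partners of [v] are equally
    likely. *)
Lemma mean_edge v w : v != w -> (N - 1) * mean (fun M => edge M v w) = 1.
Proof.
move=> vw.
have E w' : w' != v -> mean (fun M => edge M v w') = mean (fun M => edge M v w).
  move=> w'v; rewrite (mean_perm (tperm w w')); apply: eq_mean => M _.
  by rewrite -(edge_perm (tperm w w') M v w) tpermL tpermD // eq_sym.
transitivity (mean (fun M => \sum_w edge M v w)); last first.
  by rewrite -[RHS]mean_cst; apply: eq_mean => M; exact: sum_edge.
rewrite mean_sum (bigD1 v) //= (eq_bigr _ E) sumr_const.
have -> : mean (fun M => edge M v v) = 0.
  by rewrite -[RHS]mean_cst; apply: eq_mean => M; exact: edge_diag.
have -> : #|[pred i | i != v]| = (2 * n - 1)%N.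
  by rewrite (cardC1 v) card_ord subn1.
rewrite add0r -[RHS]mulr_natl natrB //.
by have := ltn_ord v; lia.
Qed.

(** Once [v] and [w] are joined, transpositions fixing [v], [w], [v'] make the [N - 3] remaining
    partners of [v'] equally likely; summing over them leaves [mean_edge]. *)
Lemma mean_edge2 v w v' w' : uniq [:: v; w; v'; w'] ->
  (N - 1) * (N - 3) * mean (fun M => edge M v w * edge M v' w') = 1.
Proof.
rewrite /= !inE !negb_or !andbT.
move=> /andP[/and3P[vw vv' vw'] /andP[/andP[wv' ww'] v'w']].
have E x : x \notin [:: v; w; v'] ->
    mean (fun M => edge M v w * edge M v' x)
      = mean (fun M => edge M v w * edge M v' w').
  rewrite !inE !negb_or => /and3P[xv xw xv'].
  rewrite (mean_perm (tperm x w')); apply: eq_mean => M _.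
  by rewrite -(edge_perm (tperm x w') M v w) -(edge_perm (tperm x w') M v' w')
    tpermR !tpermD // eq_sym.
rewrite -[RHS](mean_edge vw) -mulrA; congr (_ * _).
transitivity (mean (fun M => \sum_x edge M v w * edge M v' x)); last first.
  by apply: eq_mean => M MM; rewrite -mulr_sumr sum_edge // mulr1.
rewrite mean_sum (bigID [pred x | x \in [:: v; w; v']]) /=.
rewrite big1 ?add0r; last first.
  move=> x; rewrite !inE => xP; rewrite -[RHS]mean_cst; apply: eq_mean => M MM.
  case/or3P: xP => /eqP ->.
  - by rewrite (edgeC M v') edge_disjoint.
  - by rewrite (edgeC M v) (edgeC M v') edge_disjoint.
  - by rewrite edge_diag ?mulr0.
rewrite (eq_bigr _ E).
rewrite sumr_const -[RHS]mulr_natl; congr (_ * _).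
have card3 : #|[in [:: v; w; v']]| = 3%N.
  by apply/card_uniqP; rewrite /= !inE negb_or vw vv' wv'.
have := cardC [in [:: v; w; v']].
rewrite card3 card_ord => /(congr1 (fun k => k%:R : R)) <-.
by rewrite natrD addrC addKr; congr _%:R; apply: eq_card.
Qed.
End Mean.

(** * Second moments of sums of partner weights *)

Section LinearStatistic.
Variables (R : realFieldType) (n : nat).
Notation V := 'I_(2 * n).
Notation N := ((2 * n)%:R : R).
Implicit Types (M : {set {set V}}) (v w : V).
Variables (A : {set V}) (s : V -> R).
Hypotheses (sA0 : {in A, forall v, s v = 0}) (s_le1 : forall v, `|s v| <= 1).

(** On a matching only one term survives: this is [s] at the partner of [v]. *)
Definition partner_weight v M := \sum_w s w * edge R M v w.

Lemma partner_weight_sqr v M : M \in matchings n ->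
  partner_weight v M ^+ 2 = \sum_w s w ^+ 2 * edge R M v w.
Proof.
move=> MM; rewrite expr2 big_distrlr /=; apply: eq_bigr => w _.
rewrite (bigD1 w) //= big1 ?addr0; first by rewrite mulrACA edge_idem expr2.
by move=> w' w'w; rewrite mulrACA edge_disjoint ?mulr0 // eq_sym.
Qed.

Lemma mean_weighted_edges (t : V -> R) v : t v = 0 ->
  (N - 1) * mean (fun M => \sum_w t w * edge R M v w) = \sum_w t w.
Proof.
move=> tv; rewrite mean_sum mulr_sumr; apply: eq_bigr => w _; rewrite meanZ.
have [<-|vw] := eqVneq v w; first by rewrite tv mul0r mulr0.
by rewrite mulrCA mean_edge // mulr1.
Qed.

Lemma mean_partner_weight v : v \in A ->
  (N - 1) * mean (partner_weight v) = \sum_w s w.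
Proof. by move=> vA; rewrite mean_weighted_edges // sA0. Qed.

Lemma mean_partner_weight_sqr v : v \in A ->
  (N - 1) * mean (fun M => partner_weight v M ^+ 2) = \sum_w s w ^+ 2.
Proof.
move=> vA; rewrite (eq_mean (partner_weight_sqr v)).
by rewrite (mean_weighted_edges (t := fun w => s w ^+ 2)) // sA0 // expr0n.
Qed.

(** Distinct [v] and [v'] cannot share a partner, which removes the diagonal of the double sum. Off
    the diagonal a nonzero weight forces [w] and [w'] outside [A], so the four vertices are distinct
    and [mean_edge2] applies. *)
Lemma mean_partner_weight_mul v v' : v \in A -> v' \in A -> v != v' ->
  (N - 1) * (N - 3) * mean (fun M => partner_weight v M * partner_weight v' M)
    = (\sum_w s w) ^+ 2 - \sum_w s w ^+ 2.
Proof.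
move=> vA v'A vv'.
under eq_mean do rewrite big_distrlr /=.
rewrite mean_sum mulr_sumr expr2 big_distrlr -sumrB /=.
apply: eq_bigr => w _; rewrite mean_sum mulr_sumr (bigD1 w) //=.
rewrite [in RHS](bigD1 w) //= -expr2 addrC addrAC subrr add0r.
rewrite (_ : mean _ = 0) ?mulr0 ?addr0; last first.
  rewrite -[RHS](mean_cst n); apply: eq_mean => M MM.
  by rewrite mulrACA (edgeC _ M v) (edgeC _ M v') edge_disjoint ?mulr0.
apply: eq_bigr => w' w'w; under eq_mean do rewrite mulrACA.
rewrite meanZ.
have [wA|wA] := boolP (w \in A); first by rewrite sA0 // !mul0r mulr0.
have [w'A|w'A] := boolP (w' \in A); first by rewrite (sA0 w'A) mulr0 !mul0r mulr0.
rewrite mulrCA mean_edge2 ?mulr1 //= !inE !negb_or vv' (eq_sym w w') w'w.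
by rewrite (eq_sym w v') !(memPn wA, memPn w'A).
Qed.

(** An element of [A] contributes 0, which leaves [N - 1] terms. It is applied to [s] and to its
    square. *)
Lemma sum_weight_bound (f : V -> R) : {in A, forall v, f v = 0} ->
  (forall v, `|f v| <= 1) -> (0 < #|A|)%N -> `|\sum_w f w| <= N - 1.
Proof.
move=> fA0 f_le1 /card_gt0P[v vA].
rewrite (bigD1 v) //= fA0 // add0r (le_trans (ler_norm_sum _ _ _)) //.
rewrite (le_trans (ler_sum _ (fun w _ => f_le1 w))) // sumr_const.
by rewrite (cardC1 v) card_ord -subn1 natrB //; case: (2 * n)%N v {vA} => // -[].
Qed.

Lemma variance_bound : (#|A| + 3 <= 2 * n)%N ->
  mean (fun M => (\sum_(v in A) partner_weight v M
                   - #|A|%:R * (\sum_w s w) / (N - 1)) ^+ 2) <= 3 * #|A|%:R.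
Proof.
move=> A_small.
(* [A_small] gives [2 * n >= 3], hence at least 4 by parity; this makes [N - 3] positive. *)
have N4 : 4%:R <= N by rewrite ler_nat; lia.
set a : R := #|A|%:R; set S := \sum_w s w; set mu := a * S / (N - 1).
pose q := \sum_w s w ^+ 2.
pose E1 := mean (fun M => \sum_(v in A) partner_weight v M).
pose E2 := mean (fun M => (\sum_(v in A) partner_weight v M) ^+ 2).
have -> : mean (fun M => (\sum_(v in A) partner_weight v M - mu) ^+ 2)
    = E2 - 2 * mu * E1 + mu ^+ 2.
  rewrite /E1 /E2 -(mulNr (2 * mu)) -meanZ -meanD -[in RHS](mean_cst n (mu ^+ 2)).
  rewrite -meanD.
  by apply: eq_mean => M _; ring.
have E1E : (N - 1) * E1 = a * S.
  rewrite /E1 mean_sum mulr_sumr (eq_bigr _ mean_partner_weight).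
  by rewrite sumr_const mulr_natl.
have E2E : (N - 1) * (N - 3) * E2 = a * ((N - 3) * q + (a - 1) * (S ^+ 2 - q)).
  rewrite /E2; under eq_mean do rewrite expr2 big_distrlr /=.
  rewrite mean_sum mulr_sumr [RHS]mulr_natl -sumr_const; apply: eq_bigr => v vA.
  rewrite mean_sum (bigD1 v) //= mulrDr; congr (_ + _).
    by rewrite mulrAC mulrC /q -(mean_partner_weight_sqr vA).
  rewrite mulr_sumr (eq_bigr (fun=> S ^+ 2 - q)); last first.
    by move=> v' /andP[v'A v'v]; rewrite mean_partner_weight_mul // eq_sym.
  rewrite sumr_const /a (cardsD1 v) vA natrD /= addrAC subrr add0r mulr_natl.
  by congr (_ *+ _); apply: eq_card => w; rewrite !inE andbC.
have a_ge0 : 0 <= a by exact: ler0n.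
have a_le : a <= N - 3 by rewrite lerBrDr -natrD ler_nat.
have q_ge0 : 0 <= q by apply: sumr_ge0 => w _; exact: sqr_ge0.
have [Sbound qbound] : a * S ^+ 2 <= a * (N - 1) ^+ 2 /\ a * q <= a * (N - 1).
  case: (posnP #|A|) => [A0|A_gt0]; first by rewrite /a A0 !mul0r.
  split; rewrite ler_wpM2l //.
    by rewrite -real_normK ?num_real // lerXn2r ?nnegrE ?sum_weight_bound //; lra.
  rewrite (le_trans (ler_norm _)) // sum_weight_bound // => w.
    by move=> /sA0 ->; rewrite expr0n.
  by rewrite normrX exprn_ile1.
(* Integrality of [a] matters here: the product is negative for [a] strictly between 0 and 1. *)
have a2a : 0 <= a * (a - 1).
  rewrite /a; case: #|A| => [|k]; first by rewrite mul0r.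
  by rewrite -[X in _ - X]/(1%:R) -natrB // subn1 -natrM ler0n.
have {}E1E : E1 = mu by rewrite /mu -E1E mulrC mulKf //; lra.
rewrite E1E; pose x := N - 1; pose y := N - 3.
have [x_gt0 y_gt0] : 0 < x /\ 0 < y by rewrite /x /y; split; lra.
have xmu : x * mu = a * S by rewrite /mu mulrC divfK // gt_eqF.
have xy : x = y + 2 by rewrite /x /y; ring.
move: E2E a_le Sbound qbound; rewrite -/x -/y.
clearbody x y => E2E a_le Sbound qbound.
(* After clearing denominators with [x * x * y], the difference of the two sides splits into five
   nonnegative terms. *)
rewrite -subr_ge0 -(pmulr_rge0 _ (mulr_gt0 (mulr_gt0 x_gt0 x_gt0) y_gt0)).
have -> : x * x * y * (3 * a - (E2 - 2 * mu * mu + mu ^+ 2))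
    = x * y * (a * x - a * q) + x * (a * (a - 1)) * q + x * (a * S ^+ 2)
      + 2 * a * (a * x ^+ 2 - a * S ^+ 2) + 2 * (x ^+ 2 * a * (y - a)).
  transitivity (3 * a * x * x * y - x * (x * y * E2) + y * (x * mu) ^+ 2).
    by ring.
  by rewrite E2E xmu xy; ring.
have xge0 := ltW x_gt0; have yge0 := ltW y_gt0.
have t2 := mulr_ge0 (mulr_ge0 xge0 a2a) q_ge0.
have t3 := mulr_ge0 xge0 (mulr_ge0 a_ge0 (sqr_ge0 S)).
rewrite !addr_ge0 //.
- by rewrite mulr_ge0 ?subr_ge0 // mulr_ge0.
- by rewrite mulr_ge0 ?subr_ge0 // mulr_ge0 ?ler0n.
- by rewrite mulr_ge0 // mulr_ge0 ?subr_ge0 // mulr_ge0 ?sqr_ge0.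
Qed.

End LinearStatistic.

(** * The sockuence and its centred increments *)

Lemma sum_ord_ltn (R : pzSemiRingType) m l : (l <= m)%N ->
  \sum_(i < m) (i < l)%:R = l%:R :> R.
Proof.
move=> lm; rewrite -{2}[l]card_ord -sum1_card natr_sum.
rewrite (big_ord_widen _ (fun=> 1%:R) lm) [RHS]big_mkcond.
by apply: eq_bigr => i _; case: (_ < _)%N.
Qed.

Section Sockuence.
Variables (R : realFieldType) (n : nat).
Notation V := 'I_(2 * n).
Notation N := ((2 * n)%:R : R).
Implicit Types (M : {set {set V}}) (v w : V).

(** A crossing edge has exactly one orientation from below [k] to [k] or beyond, so ordered pairs
    count it once. *)
Lemma sockE k M : (sock k M)%:R =
  \sum_(v : V) \sum_(w : V) (v < k)%:R * (k <= w)%:R * edge R M v w.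
Proof.
pose P := [set p : V * V | [&& (p.1 < k)%N, (k <= p.2)%N & [set p.1; p.2] \in M]].
have -> : sock k M = #|P|.
  rewrite -(card_in_imset (f := fun p : V * V => [set p.1; p.2])); last first.
    move=> [v w] [v' w']; rewrite !inE /= => /and3P[vk kw _] /and3P[v'k kw' _].
    move=> E; have := set21 v w; have := set22 v w; rewrite E !inE.
    move=> /orP[]/eqP Ew; first by move: kw; rewrite Ew leqNgt v'k.
    move=> /orP[]/eqP Ev; first by rewrite Ew Ev.
    by move: vk; rewrite Ev ltnNge kw'.
  apply: eq_card => e; rewrite !inE; apply/andP/imsetP.
    case=> eM /existsP[v /existsP[w /and3P[/eqP E vk]]]; rewrite -leqNgt => kw.
    by exists (v, w) => //; rewrite inE /= vk kw -E.
  case=> -[v w]; rewrite inE /= => /and3P[vk kw eM] ->; split=> //.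
  by apply/existsP; exists v; apply/existsP; exists w; rewrite eqxx vk -leqNgt.
rewrite -sum1_card natr_sum big_mkcond pair_big /=; apply: eq_bigr => -[v w] _.
by rewrite inE /= /edge -!natrM !mulnb -andbA; case: ifP.
Qed.

Lemma card_block k l : (k <= l <= 2 * n)%N ->
  #|[set v : V | (k <= v < l)%N]| = (l - k)%N.
Proof.
move=> /andP[kl lN]; apply/eqP; rewrite -(eqr_nat int) natrB //.
rewrite -(sum_ord_ltn _ lN) -(sum_ord_ltn _ (leq_trans kl lN)) -sumrB.
rewrite -sum1_card natr_sum big_mkcond; apply/eqP; apply: eq_bigr => v _.
by rewrite inE; case: leqP => kv; case: ltnP => vl //=; lia.
Qed.

Definition side k l w : R := (l <= w)%:R - (w < k)%:R.

Lemma side_le1 k l w : `|side k l w| <= 1.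
Proof.
rewrite /side.
by do 2!case: (_ <= _)%N; rewrite ?subrr ?subr0 ?sub0r ?normrN ?normr0 ?normr1.
Qed.

(** Edges passing over the whole block cancel. What is left joins the block to the right in [sock l]
    and to the left in [sock k]. *)
Lemma sockB k l M : (k <= l)%N ->
  (sock l M)%:R - (sock k M)%:R
    = \sum_(v in [set v : V | (k <= v < l)%N]) partner_weight (side k l) v M.
Proof.
move=> kl; rewrite !sockE.
(* The second sum has [v] and [w] exchanged, so that [v] is the block vertex. *)
have -> : \sum_(v : V) \sum_(w : V) (v < k)%:R * (k <= w)%:R * edge R M v w
    = \sum_(v : V) \sum_(w : V) (v < k)%:R * (l <= w)%:R * edge R M v w
      + \sum_(v : V) \sum_(w : V) (w < k)%:R * (k <= v < l)%:R * edge R M v w.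
  rewrite [X in _ = _ + X]exchange_big /= -big_split; apply: eq_bigr => v _.
  rewrite -big_split; apply: eq_bigr => w _ /=.
  rewrite (edgeC R M w) -mulrDl -mulrDr -natrD; congr (_ * _%:R * _).
  by lia.
rewrite opprD addrA -!sumrB [RHS]big_mkcond; apply: eq_bigr => v _ /=.
rewrite -!sumrB; under eq_bigr do rewrite -!mulrBl.
rewrite inE; case: ifP => kvl; last first.
  rewrite big1 // => w _; have -> : (v < l)%N = (v < k)%N by lia.
  by rewrite /= mulr0 subrr mul0r subrr mul0r.
rewrite /partner_weight /side; apply: eq_bigr => w _.
have -> : (v < l)%N = true by lia.
have -> : (v < k)%N = false by lia.
by rewrite /= subr0 mul1r mulr1.
Qed.

(* The subtracted term is the mean of [sock k]. *)
Definition dev k M : R := (sock k M)%:R - k%:R * (N - k%:R) / (N - 1).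

(** This is [variance_bound] for one block: [side k l] has total [N - l - k], and the centring terms
    of [dev] differ by [(l - k) * (N - l - k) / (N - 1)]. *)
Lemma mean_devB_sqr k l : (k <= l <= 2 * n)%N -> (l - k + 3 <= 2 * n)%N ->
  mean (fun M => (dev l M - dev k M) ^+ 2) <= 3 * (l - k)%:R.
Proof.
move=> klN lk; have /andP[kl lN] := klN; pose A := [set v : V | (k <= v < l)%N].
have cA : #|A| = (l - k)%N by exact: card_block.
have side_sum : \sum_w side k l w = N - l%:R - k%:R.
  rewrite sumrB (sum_ord_ltn _ (leq_trans kl lN)); congr (_ - _).
  transitivity (\sum_(w : V) (1 - (w < l)%:R) : R).
    by apply: eq_bigr => w _; rewrite leqNgt; case: (w < l)%N; rewrite ?subrr ?subr0.
  by rewrite sumrB (sum_ord_ltn _ lN) sumr_const card_ord.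
have A0 : {in A, forall v, side k l v = 0}.
  move=> v; rewrite inE /side => /andP[kv vl].
  by rewrite leqNgt vl ltnNge kv subr0.
have := variance_bound A0 (side_le1 k l); rewrite cA side_sum => /(_ lk).
apply: le_trans; apply: le_mean => M _.
rewrite -sockB // natrB // le_eqVlt; apply/orP; left; apply/eqP; congr (_ ^+ 2).
by rewrite /dev; ring.
Qed.

Lemma sock_lipschitz k l M : M \in matchings n -> (k <= l <= 2 * n)%N ->
  `|(sock l M)%:R - (sock k M)%:R| <= (l - k)%:R :> R.
Proof.
move=> MM klN; have /andP[kl _] := klN.
rewrite sockB // -card_block // -sum1_card natr_sum.
rewrite (le_trans (ler_norm_sum _ _ _)) // ler_sum // => v _.
rewrite (le_trans (ler_norm_sum _ _ _)) // -(sum_edge R v MM) ler_sum // => w _.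
by rewrite normrM [`|edge _ _ _ _|]ger0_norm ?ler0n // ler_piMl ?ler0n ?side_le1.
Qed.
End Sockuence.

Lemma unif_probE (R : realType) n E :
  unif_prob R (matchings n) E = mean (fun M => (E M)%:R).
Proof.
rewrite /unif_prob /mean -sum1_card natr_sum big_mkcond [in RHS]big_mkcond.
congr (_ / _); apply: eq_bigr => M _; rewrite inE.
by case: (M \in _); case: (E M).
Qed.

Lemma ler_norm_of_sqr_div (R : realFieldType) (x t : R) :
  0 < t -> (x / t) ^+ 2 <= 1 -> `|x| <= t.
Proof.
move=> t0; rewrite -(real_normK (num_real _)) expr_le1 // normrM normfV.
by rewrite (gtr0_norm t0) ler_pdivrMr ?mul1r.
Qed.

(** * Simultaneous control of the deviations on a grid around [n] *)

Section Deviation.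
Variables (R : realFieldType) (n : nat).
Notation N := ((2 * n)%:R : R).
Implicit Types (M : {set {set 'I_(2 * n)}}).

Lemma dev0 M : dev R 0 M = 0.
Proof.
rewrite /dev !mul0r subr0 /sock (_ : [set e in M | _] = finset.set0) ?cards0 //.
apply/setP => e; rewrite !inE /crosses; apply/negP => /andP[_].
by case/existsP => i /existsP[j /and3P[]].
Qed.

Variables (g : nat) (s : R).
Hypotheses (n_ge3 : (3 <= n)%N) (s_ge1 : 1 <= s) (g_gt0 : (0 < g)%N).

Definition tol j : R := s + j%:R ^+ 2 / 8.

Lemma tol_gt0 j : 0 < tol j.
Proof. by rewrite ltr_wpDr ?divr_ge0 ?sqr_ge0 ?ler0n // (lt_le_trans ltr01). Qed.

(* Markov's inequality for this single sum of squares replaces a union bound: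
   [potential M <= 1] forces every deviation to be within its tolerance. *)
Definition potential M : R := (dev R n M / s) ^+ 2 +
  \sum_(j < n %/ g) (((dev R (n + j.+1 * g) M - dev R n M) / tol j.+1) ^+ 2
                   + ((dev R n M - dev R (n - j.+1 * g) M) / tol j.+1) ^+ 2).

Lemma potential_ge0 M : 0 <= potential M.
Proof.
by rewrite addr_ge0 ?sqr_ge0 // sumr_ge0 // => j _; rewrite addr_ge0 ?sqr_ge0.
Qed.

(* The sum telescopes, because
   1 / tol j - 1 / tol j.+1 = (2 j + 1) / (8 tol j tol j.+1). *)
Lemma sum_tol J : \sum_(j < J) j.+1%:R / tol j.+1 ^+ 2 <= 8 / s - 8 / tol J.
Proof.
elim: J => [|J IH].
  by rewrite big_ord0 /tol expr0n mul0r addr0 subrr.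
rewrite big_ord_recr /= -lerBrDr (le_trans IH) // lerBrDr addrAC lerBlDl.
have x0 := tol_gt0 J; have y0 := tol_gt0 J.+1.
set x := tol J in x0 *; set y := tol J.+1 in y0 *.
have yx : y = x + (2 * J%:R + 1) / 8 by rewrite /y /x /tol -natr1; field.
have J0 : 0 <= J%:R :> R by exact: ler0n.
clearbody x y.
suff : J.+1%:R / y ^+ 2 <= 8 / x - 8 / y by lra.
have -> : 8 / x - 8 / y = (2 * J%:R + 1) / x / y.
  have -> : 2 * J%:R + 1 = 8 * (y - x) by rewrite yx; field.
  by field; rewrite !gt_eqF.
(* The factors are compared separately: [J + 1 <= 2 * J + 1] and [1 / y <= 1 / x]. *)
rewrite expr2 invfM mulrA ler_wpM2r ?invr_ge0 ?(ltW y0) // -natr1.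
by rewrite ler_pM ?invr_ge0 ?(ltW y0) ?lef_pV2 ?posrE //; lra.
Qed.

(** The central term costs [3 * n / s ^+ 2]. At index [j] the two blocks of length [j * g] cost
    [6 * j * g / tol j ^+ 2] together, and [sum_tol] turns their total into [6 * g * 8 / s]. *)
Lemma mean_potential : mean potential <= 3 * n%:R / s ^+ 2 + 48 * g%:R / s.
Proof.
have s_gt0 : 0 < s by rewrite (lt_le_trans ltr01).
rewrite /potential meanD mean_sum lerD //.
  under eq_mean do rewrite exprMn mulrC.
  rewrite meanZ mulrC exprVn ler_wpM2r ?invr_ge0 ?sqr_ge0 //.
  rewrite (eq_mean (G := fun M => (dev R n M - dev R 0 M) ^+ 2)); last first.
    by move=> M _; rewrite dev0 subr0.
  (* A block of length [n] satisfies [n + 3 <= 2 * n] because [n >= 3]. *)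
  have := @mean_devB_sqr R n 0 n; rewrite subn0; apply; lia.
pose J := (n %/ g)%N.
have JE (j : 'I_J) : (j.+1 * g <= n)%N.
  by rewrite (leq_trans _ (leq_divM n g)) // leq_mul2r ltn_ord orbT.
apply: (@le_trans _ _ (6 * g%:R * \sum_(j < J) j.+1%:R / tol j.+1 ^+ 2)).
  rewrite mulr_sumr ler_sum // => j _; have := JE j; rewrite meanD.
  have -> : 6 * g%:R * (j.+1%:R / tol j.+1 ^+ 2)
    = (tol j.+1)^-1 ^+ 2 * (3 * (j.+1 * g)%:R)
      + (tol j.+1)^-1 ^+ 2 * (3 * (j.+1 * g)%:R).
    by rewrite natrM exprVn; ring.
  move: (j.+1 * g)%N => m mn.
  have up := mean_devB_sqr R (n := n) (k := n) (l := n + m).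
  have dn := mean_devB_sqr R (n := n) (k := n - m) (l := n).
  under eq_mean do rewrite exprMn mulrC.
  under [X in _ + X]eq_mean do rewrite exprMn mulrC.
  rewrite !meanZ lerD // ler_wpM2l ?sqr_ge0 //.
    by move: up; rewrite addKn; apply; lia.
  by move: dn; rewrite subKn //; apply; lia.
rewrite (le_trans (ler_wpM2l _ (sum_tol J))) ?mulr_ge0 ?ler0n //.
have : 0 <= 8 / tol J by rewrite divr_ge0 ?ler0n // ltW ?tol_gt0.
have -> : 48 * g%:R / s = 6 * g%:R * (8 / s) by field; rewrite gt_eqF.
by move=> ?; rewrite ler_wpM2l ?mulr_ge0 ?ler0n // gerBl.
Qed.

(** Each square is at most the whole sum. Index 0 is absent from the sum but holds trivially; it
    serves the points within one gap of [n]. *)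
Lemma potential_term M : potential M <= 1 -> forall j, (j <= n %/ g)%N ->
  [/\ `|dev R n M| <= s, `|dev R (n + j * g) M - dev R n M| <= tol j
    & `|dev R n M - dev R (n - j * g) M| <= tol j].
Proof.
move=> Phi_le1 j jJ; pose B := (dev R n M / s) ^+ 2.
pose F i := ((dev R (n + i.+1 * g) M - dev R n M) / tol i.+1) ^+ 2
            + ((dev R n M - dev R (n - i.+1 * g) M) / tol i.+1) ^+ 2.
rewrite /potential -/B in Phi_le1.
have F_ge0 i : 0 <= F i by rewrite addr_ge0 ?sqr_ge0.
have B_ge0 : 0 <= B by exact: sqr_ge0.
have s_gt0 : 0 < s by rewrite (lt_le_trans ltr01).
have S_ge0 : 0 <= \sum_(i < n %/ g) F i by exact: sumr_ge0.
have B_le1 : B <= 1 by rewrite (le_trans _ Phi_le1) // lerDl.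
have F_le1 (i : 'I_(n %/ g)) : F i <= 1.
  rewrite (le_trans _ Phi_le1) // (bigD1 i) //= ler_wpDl // lerDl.
  by apply: sumr_ge0 => i' _; exact: F_ge0.
split; first exact: ler_norm_of_sqr_div B_le1.
  case: j jJ => [|j] jJ; first by rewrite mul0n addn0 subrr normr0 ltW ?tol_gt0.
  apply: ler_norm_of_sqr_div (tol_gt0 _) (le_trans _ (F_le1 (Ordinal jJ))).
  by rewrite lerDl sqr_ge0.
case: j jJ => [|j] jJ; first by rewrite mul0n subn0 subrr normr0 ltW ?tol_gt0.
apply: ler_norm_of_sqr_div (tol_gt0 _) (le_trans _ (F_le1 (Ordinal jJ))).
by rewrite lerDr sqr_ge0.
Qed.

Hypotheses (gs : g%:R <= s) (ng : n%:R <= 4 * g%:R ^+ 2 :> R).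

(** Rounding [k] to a grid point costs at most [g <= s]. There the deviation is at most
    [2 * s + j ^ 2 / 8], and the drift of the mean absorbs [j ^ 2 / 8]. *)
Lemma sock_upper M k :
  M \in matchings n -> potential M <= 1 -> (k <= 2 * n)%N ->
  (sock k M)%:R <= n%:R / 2 + 4 * s.
Proof.
move=> MM Phi_le1 kN.
have N_gt1 : 0 < N - 1 by rewrite subr_gt0 ltr1n; lia.
have n_gt0 : 1 <= n%:R :> R by rewrite ler1n; lia.
suff [k' [j [k'E kk' jn]]] : exists k' j, [/\ (k' = n + j * g \/ k' = n - j * g)%N,
    `|(sock k M)%:R - (sock k' M)%:R| <= g%:R :> R & (j * g <= n)%N].
  have jJ : (j <= n %/ g)%N by rewrite leq_divRL.
  have [devn devp devm] := potential_term Phi_le1 jJ.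
  have dev_k' : dev R k' M <= 2 * s + j%:R ^+ 2 / 8.
    move: devn devp devm; rewrite !ler_norml /tol.
    by case: k'E => -> /andP[_ ?] /andP[? ?] /andP[? ?]; lra.
  (* Here [n ^ 2 / (2 * n - 1) <= n / 2 + 1], while [ng] gives
     [(j * g) ^ 2 / (2 * n - 1) >= j ^ 2 / 8]. *)
  have drift : k'%:R * (N - k'%:R) / (N - 1) <= n%:R / 2 + 1 - j%:R ^+ 2 / 8.
    have -> : k'%:R * (N - k'%:R) = n%:R ^+ 2 - (j%:R * g%:R) ^+ 2.
      by rewrite natrM; case: k'E => ->; rewrite ?natrB ?natrD // natrM; ring.
    rewrite ler_pdivrMr // natrM exprMn.
    have := ler_wpM2l (sqr_ge0 j%:R) ng; have := sqr_ge0 (j%:R : R).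
    move: (j%:R ^+ 2) (g%:R ^+ 2) => J G; nra.
  move: kk'; rewrite ler_norml => /andP[_ kk'].
  move: (lerD dev_k' drift); rewrite [dev _ _ _ + _]subrK => sock_k'.
  have aux (a b c d e : R) : a - b <= c -> c <= s ->
      b <= 2 * s + e / 8 + (d / 2 + 1 - e / 8) -> a <= d / 2 + 4 * s.
    by move=> *; move: s_ge1; lra.
  exact: aux kk' gs sock_k'.
(* On either side of [n], [k] is rounded towards [n], so the grid point stays within range and less
   than [g] away. *)
have [nk|kn] := leqP n k.
  exists (n + (k - n) %/ g * g)%N, ((k - n) %/ g)%N.
  have := leq_divM (k - n) g; have := ltn_ceil (k - n) g_gt0; rewrite mulSn.
  move: ((k - n) %/ g * g)%N => m ? ?; split; [by left| |lia].
  apply: (le_trans (sock_lipschitz R MM _)); first lia.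
  by rewrite ler_nat; lia.
exists (n - (n - k) %/ g * g)%N, ((n - k) %/ g)%N.
have := leq_divM (n - k) g; have := ltn_ceil (n - k) g_gt0; rewrite mulSn.
move: ((n - k) %/ g * g)%N => m ? ?; split; [by right| |lia].
rewrite distrC; apply: (le_trans (sock_lipschitz R MM _)); first lia.
by rewrite ler_nat; lia.
Qed.

(** The lower bound uses [k = n] only, where the mean [n ^ 2 / (2 * n - 1)] is at least [n / 2]. *)
Lemma potential_good M : M \in matchings n -> potential M <= 1 ->
  `|(max_sock M)%:R - n%:R / 2| <= 4 * s.
Proof.
move=> MM Phi_le1.
have le_max : (sock n M <= max_sock M)%N.
  apply: (@leq_bigmax_seq nat (index_iota 1 (2 * n).+1) xpredT
    (fun k => sock k M) n); rewrite ?mem_index_iota; lia.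
have [devn _ _] := potential_term Phi_le1 (leq0n _).
have up : (max_sock M)%:R <= n%:R / 2 + 4 * s.
  rewrite /max_sock big_nat.
  apply: (big_ind (fun x : nat => x%:R <= n%:R / 2 + 4 * s)) => [|x y|k kN].
  - by rewrite addr_ge0 ?divr_ge0 ?ler0n // mulr_ge0 ?ler0n // (le_trans ler01).
  - by rewrite /maxn; case: ifP.
  - by apply: sock_upper => //; lia.
have lo : n%:R / 2 - s <= (max_sock M)%:R :> R.
  apply: le_trans (_ : (sock n M)%:R <= _); last by rewrite ler_nat.
  have N_gt1 : 0 < N - 1 by rewrite subr_gt0 ltr1n; lia.
  have -> : (sock n M)%:R = dev R n M + n%:R * (N - n%:R) / (N - 1) :> R.
    by rewrite /dev subrK.
  move: devn; rewrite ler_norml => /andP[devn _].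
  rewrite [leLHS]addrC lerD // ler_pdivlMr // natrM.
  have := ler0n R n; nra.
rewrite ler_distl; apply/andP; split=> //.
by rewrite (le_trans _ lo) // lerB // ler_peMl ?ler1n // (le_trans ler01).
Qed.
End Deviation.

(** Markov's inequality at level 1: on matchings, [1 - F M] is at most the indicator of [E]. *)
Lemma unif_prob_ge (R : realType) n (E : pred {set {set 'I_(2 * n)}})
    (F : _ -> R) :
  (forall M, 0 <= F M) -> {in matchings n, forall M, F M <= 1 -> E M} ->
  1 - mean F <= unif_prob R (matchings n) E.
Proof.
move=> F_ge0 FE; rewrite unif_probE -{1}(mean_cst n (1 : R)) -mulN1r -meanZ -meanD.
apply: le_mean => M MM; rewrite mulN1r.
have := FE M MM; case: (E M) => /= [_|FE1]; first by rewrite -[leRHS]/(1 : R) gerBl.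
by rewrite subr_le0 leNgt; apply/negP => /ltW /FE1.
Qed.

(** By induction, [g] grows as soon as [g.+1 ^ 2] fits; otherwise the number is below
    [g.+1 ^ 2 <= (2 * g) ^ 2]. *)
Lemma exists_isqrt n : (0 < n)%N ->
  exists g, (0 < g /\ g ^ 2 <= n <= 4 * g ^ 2)%N.
Proof.
elim: n => // -[_ _|n /(_ isT)[g [g_gt0 /andP[gn ng]]] _]; first by exists 1%N.
have [gn'|ng'] := leqP (g.+1 ^ 2) n.+2; first by exists g.+1; split=> //; nia.
by exists g; split=> //; nia.
Qed.

(** * Passage to the limit *)

Local Open Scope classical_set_scope.
Local Open Scope ring_scope.

Theorem theorem1p2 (R : realType) :
  exists C : R, 0 < C /\
    (fun n : nat =>
       unif_prob R (matchings n)
         (fun M => `| (max_sock M)%:R - n%:R / 2 | <= C * Num.sqrt (n%:R * ln n%:R)))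
      @ \oo --> (1 : R).
Proof.
(* The constant is the 4 of [potential_good], taken with [s] equal to the square root of
   [n * ln n]. *)
exists 4; split=> //; apply/cvgrPdist_le => e e_gt0.
(* From [ln n >= K] follow [ln n >= 1], which gives [g <= s], and [51 / sqrt (ln n) <= e]. *)
pose K : R := Num.max 1 ((51 / e) ^+ 2).
near=> n.
have nK : expR K <= n%:R by near: n; exact: nbhs_infty_ger.
have n_ge3 : (3 <= n)%N by near: n; exact: nbhs_infty_ge.
have n_gt0 : 0 < n%:R :> R by rewrite ltr0n (leq_trans _ n_ge3).
set L : R := ln n%:R.
have KL : K <= L by rewrite -[K]expRK ler_ln ?posrE ?expR_gt0.
have L1 : 1 <= L by rewrite (le_trans _ KL) // le_max lexx.
have eL : (51 / e) ^+ 2 <= L by rewrite (le_trans _ KL) // le_max lexx orbT.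
set s := Num.sqrt (n%:R * L).
have [g [g_gt0 /andP[gn ng]]] := exists_isqrt (leq_trans (isT : (0 < 3)%N) n_ge3).
have L0 : 0 <= L by exact: le_trans L1.
have gs : g%:R * Num.sqrt L <= s.
  rewrite /s sqrtrM ?ler0n // ler_wpM2r ?sqrtr_ge0 //.
  by rewrite -[leLHS]ger0_norm ?ler0n // -sqrtr_sqr ler_sqrt // -natrX ler_nat.
have rL1 : 1 <= Num.sqrt L by rewrite -[leLHS]sqrtr1 ler_sqrt // (lt_le_trans ltr01).
have g_le : g%:R <= s by rewrite (le_trans _ gs) // ler_peMr.
have s1 : 1 <= s by rewrite (le_trans _ g_le) // ler1n.
have ng4 : n%:R <= 4 * g%:R ^+ 2 :> R by rewrite -natrX -natrM ler_nat.
have s_gt0 : 0 < s by rewrite (lt_le_trans ltr01).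
have rL_gt0 : 0 < Num.sqrt L by rewrite (lt_le_trans ltr01).
(* With [L = ln n], [3 * n / s ^+ 2 = 3 / L] is at most [3 / sqrt L], and [gs] bounds [48 * g / s]
   by [48 / sqrt L]; hence [51 = 3 + 48]. *)
have bound : mean (potential (n := n) g s) <= 51 / Num.sqrt L.
  apply: le_trans (mean_potential n_ge3 s1 g_gt0) _.
  have -> : 51 / Num.sqrt L = 3 / Num.sqrt L + 48 / Num.sqrt L.
    by rewrite -mulrDl -natrD.
  rewrite lerD //.
    rewrite ler_pdivrMr ?exprn_gt0 // mulrAC ler_pdivlMr // /s.
    rewrite sqr_sqrtr ?mulr_ge0 ?ler0n //.
    rewrite -mulrA ler_wpM2l ?ler0n // ler_wpM2l ?ler0n //.
    by rewrite -{2}(sqr_sqrtr L0) expr2 ler_peMl // ltW.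
  by rewrite ler_pdivrMr // mulrAC ler_pdivlMr // -mulrA ler_wpM2l ?ler0n.
have rLe : 51 / Num.sqrt L <= e.
  have e51 : 0 <= 51 / e by rewrite divr_ge0 ?ler0n // ltW.
  rewrite ler_pdivrMr // [leRHS]mulrC -ler_pdivrMr // -[leLHS](ger0_norm e51).
  by rewrite -sqrtr_sqr ler_sqrt // (lt_le_trans ltr01).
set P := unif_prob _ _ _.
have P_le1 : P <= 1.
  rewrite /P unif_probE (le_trans (le_mean (G := fun=> 1) _)) ?mean_cst // => M _.
  by rewrite lern1 leq_b1.
have P_ge : 1 - mean (potential (n := n) g s) <= P.
  apply: unif_prob_ge => [M|M MM Phi_le1]; first exact: potential_ge0.
  exact: potential_good n_ge3 s1 g_gt0 g_le ng4 _ MM Phi_le1.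
rewrite ger0_norm ?subr_ge0 //; lra.
Unshelve. all: by end_near.
Qed.
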